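(* Fix any $\varepsilon>0$ and $n\in\mathbb N_+$. Consider the algorithm which, given a simple undirected graph $G=([n],E)$: sets $\varepsilon_0=\varepsilon/2$; for each $v\in[n]$ independently chooses $c_1(v),c_2(v)\in\{-1,+1\}$ uniformly at random; lets $\ell(v)=|\{u:\{u,v\}\in E,\ c_1(u)=c_1(v)\}|$; for each $v$ samples independent $\zeta_v\sim\mathrm{DLap}(1/\varepsilon_0)$ and sets $c(v)=c_1(v)$ if $\ell(v)-\lceil\frac{d(v)-1}2\rceil+\zeta_v\le0$ and $c(v)=c_2(v)$ otherwise; and outputs $S=\{v:c(v)=+1\}$. This algorithm is $(\varepsilon,0)$-differentially private. Furthermore, if $G$ is triangle-free, then for every edge $\{u,v\}\in E$, the probability that exactly one of $u,v$ lies in $S$ is at least $$\frac12+\Omega\left(\frac1{\sqrt{d(u)+1/\varepsilon^2}}+\frac1{\sqrt{d(v)+1/\varepsilon^2}}\right),$$ with an absolute hidden constant.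
   Context: $d(v)$ is the degree of $v$ in $G$. $\mathrm{DLap}(1/\varepsilon_0)$ is the discrete Laplace distribution on $\mathbb Z$ with mass $\frac{e^{\varepsilon_0}-1}{e^{\varepsilon_0}+1}e^{-\varepsilon_0|x|}$ at $x$. Edge-level privacy: two graphs on vertex set $[n]$ are neighboring if they differ by exactly one edge; $(\varepsilon,0)$-DP means $\Pr[\mathcal M(G)\in T]\le e^\varepsilon\Pr[\mathcal M(G')\in T]$ for all neighboring $G,G'$ and output sets $T$. *)

(* Defs.v *)
From HB Require Import structures.
From mathcomp Require Import all_boot all_order all_algebra.
From mathcomp Require Import all_classical all_reals all_analysis.
Set Implicit Arguments. Unset Strict Implicit. Unset Printing Implicit Defensive.
Import Order.TTheory GRing.Theory Num.Theory.
Local Open Scope ring_scope.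
Local Open Scope classical_set_scope.

Definition simple_graph (n : nat) (G : rel 'I_n) : Prop :=
  (forall x y, G x y = G y x) /\ (forall x, ~~ G x x).

Definition triangle_free (n : nat) (G : rel 'I_n) : Prop :=
  forall a b c, G a b -> G b c -> ~~ G a c.

Definition deg (n : nat) (G : rel 'I_n) (v : 'I_n) : nat := #|[set u | G v u]|.

Definition edge_neighbors (n : nat) (G G' : rel 'I_n) : Prop :=
  exists a b : 'I_n, a != b /\ G a b != G' a b /\
    (forall x y, ~~ (((x == a) && (y == b)) || ((x == b) && (y == a))) ->
       G x y = G' x y).

Definition dlap_pmf (R : realType) (eps0 : R) (x : int) : R :=
  (expR eps0 - 1) / (expR eps0 + 1) * expR (- (eps0 * (`|x|%:~R))).

(* Randomness of the algorithm: c1, c2 in {-1,+1}^n (true = +1) and zeta in Z^n. *)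
Definition rand_space (n : nat) : Type :=
  ({ffun 'I_n -> bool} * {ffun 'I_n -> bool} * {ffun 'I_n -> int})%type.

(* Probability mass of a randomness outcome: c1, c2 uniform, zeta_v iid DLap(1/eps0),
   all independent; eps0 = eps/2. *)
Definition rand_mass (R : realType) (eps : R) (n : nat) (w : rand_space n) : R :=
  (4%:R ^- n) * \prod_(v < n) dlap_pmf (eps / 2) (w.2 v).

Definition ell (n : nat) (G : rel 'I_n) (c1 : {ffun 'I_n -> bool}) (v : 'I_n) : nat :=
  #|[set u | G u v && (c1 u == c1 v)]|.

Definition mech_out (R : realType) (n : nat) (G : rel 'I_n) (w : rand_space n)
  : {set 'I_n} :=
  let c1 := w.1.1 in let c2 := w.1.2 in let zeta := w.2 in
  [set v | if ((ell G c1 v)%:Z - Num.ceil (((deg G v)%:R - 1) / 2 : R) + zeta v <= 0)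
           then c1 v else c2 v].

Definition mech_prob (R : realType) (eps : R) (n : nat) (G : rel 'I_n)
  (T : set {set 'I_n}) : \bar R :=
  (\esum_(w in [set: rand_space n])
     ((rand_mass eps w)%:E * (if `[< T (mech_out R G w) >] then 1 else 0)%E))%E.

(* Main.v *)
(** Privacy: when one edge [{a, b}] is toggled, the comparison made at [a] (and
    at [b]) moves by at most 1 for every colouring [c1], because [ell] and the
    threshold move in the same direction. Translating the two noises
    accordingly is a bijection of the randomness that preserves the output and
    costs a factor [expR (eps / 2)] at each endpoint.

    Utility: a vertex that falls back on [c2] is cut from its neighbour with
    probability 1/2, so the gain over 1/2 only comes from both endpoints keeping
    [c1]. Given [c1 u] and [c1 v], triangle-freeness makes the colours of the
    other neighbours of [u] and [v] independent, and the gain is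
    (p_u p_v - q_u q_v) / 4, where p (resp. q) is the probability that
    Bin(d - 1, 1/2) plus the noise is at most [d / 2] (resp. [d / 2 - 1]). By
    reflection p + q >= 1, so the gain is at least the sum of the p - q over 8,
    and p - q is the probability that the sum hits [d / 2]. As the discrete
    Laplace law is a lazy random walk stopped at an independent geometric time,
    this is the return probability of a walk of length d + O(1 / eps^2). It is
    bounded below by comparing the recursion that it satisfies with the
    convex function x^(-1/2). *)

Require Import Defs.
From HB Require Import structures.
From mathcomp Require Import all_boot all_order all_algebra.
From mathcomp Require Import all_classical all_reals all_analysis.
From mathcomp Require Import lra zify.
Import Order.TTheory GRing.Theory Num.Theory.
Local Open Scope ring_scope.
Local Open Scope classical_set_scope.
Set Implicit Arguments. Unset Strict Implicit. Unset Printing Implicit Defensive.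

(** * Binomial averages and the return probability of the simple walk *)

(* The expectation of [phi (x + B)] for B ~ Bin(m, 1/2). *)
Fixpoint avg (R : realFieldType) (m : nat) (phi : int -> R) (x : int) : R :=
  if m is m'.+1 then (avg m' phi x + avg m' phi (x + 1)) / 2 else phi x.

Lemma eq_avg (R : realFieldType) m (phi psi : int -> R) x :
  phi =1 psi -> avg m phi x = avg m psi x.
Proof. by move=> e; elim: m x => [|m IH] x /=; rewrite ?e ?IH. Qed.

Lemma avg_linear (R : realFieldType) m (a b : R) (phi psi : int -> R) x :
  avg m (fun y => a * phi y + b * psi y) x = a * avg m phi x + b * avg m psi x.
Proof. by elim: m x => [|m IH] x //=; rewrite !IH; lra. Qed.

Lemma avg_shift (R : realFieldType) m (phi : int -> R) c x :
  avg m (fun y => phi (y + c)) x = avg m phi (x + c).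
Proof. by elim: m x => [|m IH] x //=; rewrite !IH addrAC. Qed.

Lemma le_avg (R : realFieldType) m (phi psi : int -> R) x :
  (forall y, phi y <= psi y) -> avg m phi x <= avg m psi x.
Proof.
move=> le; elim: m x => [|m IH] x //=.
by rewrite ler_pM2r ?invr_gt0 ?ltr0n// lerD.
Qed.

Lemma avg_cst (R : realFieldType) m (a : R) x : avg m (fun=> a) x = a.
Proof. by elim: m x => [|m IH] x //=; rewrite !IH; lra. Qed.

(** The law of [B] is symmetric about [m / 2]: [m - B] has the same law. *)
Lemma avg_opp (R : realFieldType) m (phi : int -> R) x :
  avg m (fun y => phi (- y)) x = avg m phi (- x - m%:Z).
Proof.
elim: m x => [|m IH] x /=; first by rewrite subr0.
rewrite !IH addrC; congr ((avg _ _ _ + avg _ _ _) / 2); lia.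
Qed.

Lemma avg_delta (R : realFieldType) m (j : nat) :
  avg m (fun y : int => (y == 0)%:R : R) (- j%:Z) = 'C(m, j)%:R / 2 ^+ m.
Proof.
(* Steps are 0 or 1, so 0 is never hit from a positive start. This settles [j = 0], where Pascal's
   rule has only one term. *)
have pos : forall k (x : int), 0 < x -> avg k (fun y : int => (y == 0)%:R : R) x = 0.
  elim=> [|k IH] x x0 /=; first by rewrite gt_eqF.
  rewrite !IH ?addr0 ?mul0r//; lia.
elim: m j => [|m IH] j /=.
  by rewrite oppr_eq0 bin0n expr0 divr1.
case: j => [|j].
  have := IH 0%N; rewrite oppr0 add0r (pos _ 1)// => ->.
  by rewrite !bin0 exprS invfM; lra.
rewrite (_ : - j.+1%:Z + 1 = - j%:Z); last lia.
by rewrite !IH binS natrD exprS invfM; lra.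
Qed.

Lemma central_bin_rec k : (k.+1 * 'C(k.+1.*2, k.+1) = 2 * (k.*2.+1 * 'C(k.*2, k)))%N.
Proof.
rewrite doubleS binS -(@bin_sub k.*2.+1 k.+1); last by lia.
rewrite (_ : k.*2.+1 - k.+1 = k)%N; last by lia.
rewrite addnn -mul2n mulnCA (mul_bin_down k.*2.+1 k); congr (2 * (_ * _))%N; lia.
Qed.

(** This is [4 ^ k <= 2 * sqrt k * 'C(k.*2, k)], squared to stay in [nat]. By [central_bin_rec], the
    induction step reduces to [4 * k * (k + 1) <= (2 * k + 1) ^ 2]. *)
Lemma central_bin_ge k : (0 < k -> 16 ^ k <= 4 * k * 'C(k.*2, k) ^ 2)%N.
Proof.
case: k => // k _; elim: k => [//|k IH].
have := central_bin_rec k.+1; set A := 'C(_, k.+2).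
set B := 'C(_, _) in IH *; move: A B IH => A B IH e.
rewrite -(@leq_pmul2l k.+2)// [X in (_ <= X)%N](_ : _ = 4 * (k.+2 * A) ^ 2)%N; last by rewrite expnMn; nia.
rewrite e expnS.
apply: (@leq_trans (k.+2 * (16 * (4 * k.+1 * B ^ 2)))%N); first by rewrite !leq_mul.
rewrite !expnMn.
rewrite [X in (X <= _)%N](_ : _ = 16 * B ^ 2 * (4 * (k.+1 * k.+2)))%N; last by nia.
rewrite [X in (_ <= X)%N](_ : _ = 16 * B ^ 2 * k.+1.*2.+1 ^ 2)%N; last by nia.
rewrite leq_mul2l; apply/orP; right; nia.
Qed.

(** Squaring reduces the bound to [central_bin_ge]; [k.+1] in place of [k] avoids a zero denominator
    at [k = 0]. *)
Lemma central_prob_ge (R : realType) k :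
  (2 * Num.sqrt k.+1%:R)^-1 <= avg k.*2 (fun y : int => (y == 0)%:R : R) (- k%:Z).
Proof.
rewrite avg_delta ler_pdivlMr ?exprn_gt0// mulrC ler_pdivrMr ?mulr_gt0 ?sqrtr_gt0 ?ltr0n//.
rewrite mulrC.
case: k => [|k]; first by rewrite sqrtr1 expr0 bin0; lra.
have := @central_bin_ge k.+1 isT; move: ('C(_, _)) => B.
rewrite -(ler_nat R) !natrM !natrX => le.
rewrite -ler_sqr ?nnegrE ?exprn_ge0 ?mulr_ge0 ?sqrtr_ge0//.
rewrite -exprM (_ : 2 ^+ (k.+1.*2 * 2) = 16 ^+ k.+1 :> R); last first.
  by rewrite (_ : (k.+1.*2 * 2 = 4 * k.+1)%N); [rewrite exprM; congr (_ ^+ _); rewrite -natrX|lia].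
apply: (le_trans le); rewrite exprMn [(2 * _) ^+ 2]exprMn sqr_sqrtr// -[2 ^+ 2]/(2 * 2 : R).
have : 0 <= (B%:R : R) ^+ 2 by rewrite sqr_ge0.
rewrite -(natr1 k.+1); lra.
Qed.

(** * Comparison with the inverse square root *)

(* Otherwise h - b would grow geometrically, against the bounds on b and h. *)
Lemma supersolution_ge (R : realType) (s M : R) (b h p : nat -> R) k :
  0 < s -> (forall j, 0 <= b j) -> (forall j, h j <= M) ->
  (forall j, b j.+1 = (1 + s) * b j - s * p j) ->
  (forall j, h j - h j.+1 <= s * (p j - h j)) -> h k <= b k.
Proof.
move=> s0 b0 hM brec hrec; rewrite leNgt; apply/negP => lt.
pose D j := h j - b j.
have D0 : 0 < D k by rewrite subr_gt0.
(* Bernoulli's inequality: a lower bound linear in [j] is already unbounded. *)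
have grow j : (1 + j%:R * s) * D k <= D (k + j)%N.
  elim: j => [|j IH]; first by rewrite addn0 mul0r addr0 mul1r.
  have step : (1 + s) * D (k + j)%N <= D (k + j).+1.
    by have := hrec (k + j)%N; rewrite /D brec; lra.
  rewrite addnS; apply: le_trans step.
  have : (1 + s) * ((1 + j%:R * s) * D k) <= (1 + s) * D (k + j)%N.
    by rewrite ler_pM2l//; lra.
  apply: le_trans; rewrite mulrA ler_pM2r// -natr1.
  have : 0 <= j%:R * s * s by rewrite !mulr_ge0// ltW.
  by lra.
(* The chosen [j] satisfies [j * s * D k > |M|], whereas [D (k + j) <= M] because [b] is
   nonnegative. *)
have := archi_boundP (divr_ge0 (normr_ge0 M) (ltW (mulr_gt0 s0 D0))).
rewrite ltr_pdivrMr ?mulr_gt0//.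
have := grow (Num.bound (`|M| / (s * D k))); set j := Num.bound _ => le1 lt2.
have := hM (k + j)%N; have := b0 (k + j)%N; have := ler_norm M.
by move: le1; rewrite /D -/j; move: lt2 D0; rewrite /D; lra.
Qed.

Lemma inv_doubleB (R : realFieldType) (a b : R) : a != 0 -> b != 0 ->
  (2 * a)^-1 - (2 * b)^-1 = (b - a) / (2 * (a * b)).
Proof.
move=> a0 b0; rewrite !invfM.
have ea : a * a^-1 * b^-1 = b^-1 by rewrite divff// mul1r.
have eb : b * b^-1 * a^-1 = a^-1 by rewrite divff// mul1r.
lra.
Qed.

(** Convexity of [x^(-1/2)]: its secant is no steeper between [y + s^-1] and [y + 1 + s^-1] than
    between [y] and [y + s^-1]. In terms of the three roots [a <= b <= c], the sides are
    [1 / (2bc(b + c))] and [1 / (2ab(a + b))]. *)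
Lemma inv_sqrt_step (R : realType) (s y : R) : 0 < s -> 0 < y ->
  (2 * Num.sqrt (y + s^-1))^-1 - (2 * Num.sqrt (y + 1 + s^-1))^-1
  <= s * ((2 * Num.sqrt y)^-1 - (2 * Num.sqrt (y + s^-1))^-1).
Proof.
move=> s0 y0; have si0 : 0 < s^-1 by rewrite invr_gt0.
set a := Num.sqrt y; set b := Num.sqrt (y + _); set c := Num.sqrt _.
have a0 : 0 < a by rewrite sqrtr_gt0.
have b0 : 0 < b by rewrite sqrtr_gt0 addr_gt0.
have c0 : 0 < c by rewrite sqrtr_gt0 !addr_gt0.
have ea : a ^+ 2 = y by rewrite sqr_sqrtr// ltW.
have eb : b ^+ 2 = y + s^-1 by rewrite sqr_sqrtr// ltW// addr_gt0.
have ec : c ^+ 2 = y + 1 + s^-1 by rewrite sqr_sqrtr// ltW// !addr_gt0.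
have ab : a <= b by rewrite ler_sqrt; lra.
have bc : b <= c by rewrite ler_sqrt; lra.
have es : s = (b ^+ 2 - a ^+ 2)^-1 by rewrite eb ea addrAC subrr add0r invrK.
have ab2 : (b - a) * (b + a) != 0.
  by rewrite -subr_sqr eb ea addrAC subrr add0r gt_eqF.
have -> : s * ((2 * a)^-1 - (2 * b)^-1) = (2 * (a * b * (a + b)))^-1.
  have ba0 : b - a != 0 by apply: contra ab2 => /eqP ->; rewrite mul0r.
  rewrite inv_doubleB ?gt_eqF// es subr_sqr invfM mulrACA mulVf// mul1r -invfM.
  by congr (_^-1); lra.
have -> : (2 * b)^-1 - (2 * c)^-1 = (2 * (b * c * (b + c)))^-1.
  have cb0 : c + b != 0 by rewrite gt_eqF// addr_gt0.
  have -> : (2 * b)^-1 - (2 * c)^-1 = (c + b)^-1 / (2 * (b * c)).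
    rewrite inv_doubleB ?gt_eqF//; congr (_ / _); apply: (mulIf cb0).
    by rewrite mulVf// -subr_sqr ec eb; lra.
  by rewrite -invfM; congr (_^-1); lra.
rewrite lef_pV2 ?posrE ?mulr_gt0 ?addr_gt0// ler_pM2l//.
apply: ler_pM; [by rewrite mulr_ge0 ?ltW|by rewrite addr_ge0 ?ltW| |by rewrite lerD].
by rewrite mulrC ler_pM2l// (le_trans ab).
Qed.

(** * The discrete Laplace law as a stopped lazy walk *)

Lemma dlap_pmf_ge0 (R : realType) (e0 : R) (x : int) : 0 < e0 -> 0 <= dlap_pmf e0 x.
Proof.
move=> e00; rewrite mulr_ge0 ?expR_ge0// divr_ge0//.
by rewrite subr_ge0 -expR0 ler_expR ltW.
Qed.

Lemma dlap_pmfN (R : realType) (e0 : R) (x : int) : dlap_pmf e0 (- x) = dlap_pmf e0 x.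
Proof. by rewrite /dlap_pmf normrN. Qed.

Lemma dlap_pmf_nat (R : realType) (e0 : R) (n : nat) :
  dlap_pmf e0 n = (expR e0 - 1) / (expR e0 + 1) * (expR e0)^-1 ^+ n.
Proof. by rewrite /dlap_pmf ger0_norm// -pmulrn -mulNr expRM_natr expRN. Qed.

Lemma dlap_norm (R : realType) (e0 : R) :
  let K := (expR e0 - 1) / (expR e0 + 1) in
  K * expR e0 = expR e0 - 1 - K /\ K * (expR e0)^-1 = 1 - (expR e0)^-1 - K.
Proof.
move=> K; have E0 : expR e0 != 0 by rewrite gt_eqF ?expR_gt0.
have KE : K * (expR e0 + 1) = expR e0 - 1.
  by rewrite divfK// gt_eqF ?addr_gt0 ?expR_gt0.
have Ei : (expR e0) * (expR e0)^-1 = 1 by rewrite divff.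
have : K * (expR e0 + 1) * (expR e0)^-1 = (expR e0 - 1) * (expR e0)^-1 by rewrite KE.
have : K * (expR e0 * (expR e0)^-1) = K by rewrite Ei mulr1.
by split; lra.
Qed.

(* [s] is the square of sinh (e0 / 2). The discrete Laplace law is that of a
   lazy simple random walk stopped at a geometric time of mean [s^-1]. *)
Definition lazy_rate (R : realType) (e0 : R) : R :=
  (expR e0 + (expR e0)^-1 - 2) / 4.

(** Off the origin, geometric decay makes the mass an eigenfunction of the second difference; the
    cusp at 0 gives the extra term. Equivalently, one lazy step turns the law into [1 + s] times
    itself minus [s] times the point mass at 0. *)
Lemma dlap_pmf_rec (R : realType) (e0 : R) (x : int) :
  let s := lazy_rate e0 in
  dlap_pmf e0 (x + 1) + dlap_pmf e0 (x - 1) =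
  (2 + 4 * s) * dlap_pmf e0 x - 4 * s * (x == 0)%:R.
Proof.
rewrite /lazy_rate /=.
have [KE KV] := dlap_norm e0.
have Ei : expR e0 * (expR e0)^-1 = 1 by rewrite divff// gt_eqF ?expR_gt0.
wlog: x / 0 <= x.
  move=> H; case: (leP 0 x) => [/H//|x0].
  rewrite -(dlap_pmfN _ (x + 1)) -(dlap_pmfN _ (x - 1)) -(dlap_pmfN _ x) -[x == 0]oppr_eq0.
  rewrite (opprD x 1) (opprB x 1) [1 - x]addrC.
  have nx0 : 0 <= - x by rewrite oppr_ge0 ltW.
  exact: etrans (addrC _ _) (H _ nx0).
case: x => // -[|n] _.
  rewrite add0r sub0r dlap_pmfN (dlap_pmf_nat _ 1) (dlap_pmf_nat _ 0) eqxx expr0 expr1 mulr1n /=.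
  lra.
have -> : n.+1%:Z + 1 = n.+2%:Z by rewrite -PoszD addn1.
have -> : n.+1%:Z - 1 = n%:Z by rewrite -addn1 PoszD addrK.
rewrite !dlap_pmf_nat mulr0 !exprS; set K := _ / _; set I := _ ^+ n.
have : K * (expR e0 * (expR e0)^-1) * I = K * I by rewrite Ei mulr1.
lra.
Qed.

(** This is the square of [sinh t >= t / 2] at [t = e0 / 2], which follows from [1 + t <= expR t]
    and [expR (- t) <= 1]. *)
Lemma lazy_rate_ge (R : realType) (e0 : R) : 0 < e0 -> e0 ^+ 2 / 16 <= lazy_rate e0.
Proof.
move=> e00; rewrite /lazy_rate.
set y := expR (e0 / 2).
have y1 : 1 + e0 / 2 <= y by apply: expR_ge1Dx.
have y0 : 0 < y by apply: expR_gt0.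
have -> : expR e0 = y ^+ 2 by rewrite -expRM_natl; congr expR; lra.
have -> : (y ^+ 2 + (y ^+ 2)^-1 - 2) / 4 = ((y - y^-1) / 2) ^+ 2.
  have : y * y^-1 = 1 by rewrite divff// gt_eqF.
  by rewrite -exprVn; lra.
have -> : e0 ^+ 2 / 16 = (e0 / 4) ^+ 2 by lra.
have : y^-1 <= 1 by rewrite invf_le1//; lra.
move=> ?; rewrite ler_sqr ?nnegrE; lra.
Qed.

(** Two fair 0/1 steps, recentred by -1, form one lazy step, to which [dlap_pmf_rec] applies. *)
Lemma lazy_walk_dlap_rec (R : realType) (e0 : R) k :
  let s := lazy_rate e0 in
  avg k.+1.*2 (dlap_pmf e0) (- k.+1%:Z) =
  (1 + s) * avg k.*2 (dlap_pmf e0) (- k%:Z)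
  - s * avg k.*2 (fun y : int => (y == 0)%:R) (- k%:Z).
Proof.
move=> s; set d := fun y : int => _; rewrite doubleS /=.
set A := avg k.*2 (dlap_pmf e0).
have H : A (- k%:Z + 1) + A (- k%:Z - 1) =
   (2 + 4 * s) * A (- k%:Z) + - (4 * s) * avg k.*2 d (- k%:Z).
  rewrite -avg_linear /A -!avg_shift -[X in X + _]mul1r -[X in _ + X]mul1r -avg_linear.
  by apply: eq_avg => y; rewrite !mul1r dlap_pmf_rec mulNr.
rewrite (_ : - k.+1%:Z = - k%:Z - 1) ?subrK; last by lia.
lra.
Qed.

Lemma lazy_walk_dlap_ge (R : realType) (e0 : R) k : 0 < e0 ->
  (2 * Num.sqrt (k.+1%:R + (lazy_rate e0)^-1))^-1 <= avg k.*2 (dlap_pmf e0) (- k%:Z).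
Proof.
move=> e00; set s := lazy_rate e0.
have s0 : 0 < s by apply: lt_le_trans (lazy_rate_ge e00); rewrite divr_gt0 ?exprn_gt0.
(* Here [b] is the quantity to bound, [h] the candidate lower bound and [p] the return probability
   without noise; [M] is [h] with the integer under the root dropped. *)
apply: (@supersolution_ge R s (2 * Num.sqrt s^-1)^-1
  (fun k => avg k.*2 (dlap_pmf e0) (- k%:Z))
  (fun k => (2 * Num.sqrt (k.+1%:R + s^-1))^-1)
  (fun k => avg k.*2 (fun y : int => (y == 0)%:R) (- k%:Z))) => //.
- move=> j; rewrite -[leLHS](avg_cst j.*2 0 (- j%:Z)); apply: le_avg => y.
  exact: dlap_pmf_ge0.
- move=> j; rewrite lef_pV2 ?posrE ?mulr_gt0 ?sqrtr_gt0 ?addr_gt0 ?invr_gt0//.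
  by rewrite ler_pM2l// ler_wsqrtr// lerDr.
- by move=> j; rewrite lazy_walk_dlap_rec.
- move=> j; rewrite -[j.+2%:R]natr1; apply: le_trans (inv_sqrt_step s0 _) _ => //.
  by rewrite ler_pM2l// lerB// central_prob_ge.
Qed.

(** For odd [d] the numbers of steps agree. For even [d] the right side has one more step, but the
    two positions it can lead to are mirror images for the remaining walk, so their averages are
    equal. *)
Lemma avg_dlap_half (R : realType) (e0 : R) d : (0 < d)%N ->
  avg d.-1 (dlap_pmf e0) (- (d./2)%:Z) = avg (d./2).*2 (dlap_pmf e0) (- (d./2)%:Z).
Proof.
case: d => // d _; rewrite /= -{1}(odd_double_half d) uphalf_half.
case: (odd d) => //; rewrite !add1n doubleS.
set k := _./2; pose A := avg k.*2.+1 (dlap_pmf e0).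
have AE : A (- k.+1%:Z + 1) = A (- k.+1%:Z).
  rewrite /A (@eq_avg _ _ _ (fun y => dlap_pmf e0 (- y))) ?avg_opp.
    by congr avg; lia.
  by move=> y; rewrite dlap_pmfN.
by change (A (- k.+1%:Z) = (A (- k.+1%:Z) + A (- k.+1%:Z + 1)) / 2); rewrite AE; lra.
Qed.

Lemma avg_dlap_ge (R : realType) (eps : R) d : 0 < eps -> (0 < d)%N ->
  1 / 16 * (1 / Num.sqrt (d%:R + 1 / eps ^+ 2)) <=
  avg d.-1 (dlap_pmf (eps / 2)) (- (d./2)%:Z).
Proof.
move=> e0 d0; rewrite avg_dlap_half//.
have e20 : 0 < eps / 2 by rewrite divr_gt0.
apply: le_trans (lazy_walk_dlap_ge _ e20).
have s0 := lazy_rate_ge e20; set s := lazy_rate _ in s0 *.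
have e64 : (eps / 2) ^+ 2 / 16 = eps ^+ 2 / 64 by lra.
have p64 : 0 < eps ^+ 2 / 64 by rewrite divr_gt0 ?exprn_gt0.
have sp : 0 < s by apply: lt_le_trans s0; rewrite e64.
have q0 : 0 < eps ^+ 2 by rewrite exprn_gt0.
have x0 : 0 < d%:R + 1 / eps ^+ 2 by rewrite addr_gt0 ?ltr0n ?divr_gt0.
(* The factor 64 comes from [s >= (eps / 2) ^ 2 / 16]. Used for the degree term as well, it leaves
   the root as 8 and yields the constant [1 / 16]. *)
have le1 : s^-1 <= 64 * (1 / eps ^+ 2).
  rewrite (_ : 64 * _ = (eps ^+ 2 / 64)^-1); last by rewrite invf_div mul1r.
  by rewrite lef_pV2 ?posrE// -e64.
have le2 : (d./2).+1%:R <= 64 * d%:R :> R by rewrite -natrM ler_nat; lia.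
have -> : 1 / 16 * (1 / Num.sqrt (d%:R + 1 / eps ^+ 2)) =
    (2 * Num.sqrt (64 * (d%:R + 1 / eps ^+ 2)))^-1.
  rewrite sqrtrM// (_ : 64 = 8 ^+ 2) ?sqrtr_sqr ?ger0_norm//; last by lra.
  by rewrite !invfM; lra.
have y0 : 0 < (d./2).+1%:R + s^-1 by rewrite addr_gt0 ?invr_gt0 ?ltr0n.
rewrite lef_pV2 ?posrE; last 2 first.
- by rewrite mulr_gt0 ?sqrtr_gt0 // mulr_gt0.
- by rewrite mulr_gt0 ?sqrtr_gt0.
by rewrite ler_pM2l// ler_wsqrtr// mulrDr lerD.
Qed.

(** * Averaged tails: differences and reflection *)

Section KeepProbability.
Context (R : realType) (e0 : R) (tail : int -> R).
Hypotheses (e00 : 0 < e0) (tailB : forall x, tail x - tail (x + 1) = dlap_pmf e0 x)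
  (tailN : forall x, tail x + tail (1 - x) = 1).

Lemma tail_anti (x y : int) : x <= y -> tail y <= tail x.
Proof.
move=> xy; have -> : y = x + `|y - x|%N by lia.
elim: `|_|%N => [|n IH]; first by rewrite addr0.
apply: le_trans IH; rewrite (_ : x + n.+1 = x + n%:Z + 1); last by lia.
by rewrite -subr_ge0 tailB dlap_pmf_ge0.
Qed.

Lemma avg_tail_anti m (x y : int) : x <= y -> avg m tail y <= avg m tail x.
Proof.
move=> xy; rewrite -[y](subrK x) addrC -avg_shift; apply: le_avg => z.
by apply: tail_anti; lia.
Qed.

Lemma avg_tailB m x : avg m tail x - avg m tail (x + 1) = avg m (dlap_pmf e0) x.
Proof.
rewrite -avg_shift -[avg m tail x]mul1r -mulN1r -avg_linear.
by apply: eq_avg => y; rewrite mul1r mulN1r tailB.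
Qed.

(** By [tailN] and the symmetry of the binomial law, the second term is 1 minus the average started
    at [d./2 - (d - 1)]. As [d - 1 <= 2 * d./2], this start is at least [- d./2], and the averaged
    tail is nonincreasing. *)
Lemma avg_tailD_ge1 d : (0 < d)%N ->
  1 <= avg d.-1 tail (- (d./2)%:Z) + avg d.-1 tail (- (d./2)%:Z + 1).
Proof.
move=> d0; have -> : avg d.-1 tail (- (d./2)%:Z + 1) =
   1 - avg d.-1 tail ((d./2)%:Z - d.-1%:Z).
  have := avg_opp d.-1 tail (- (d./2)%:Z); rewrite opprK => <-.
  rewrite -avg_shift -(avg_cst d.-1 1 (- (d./2)%:Z)).
  rewrite -[avg _ (fun=> 1) _]mul1r -[- avg _ _ _]mulN1r -avg_linear.
  by apply: eq_avg => y; have := tailN (- y); rewrite opprK [1 + y]addrC; lra.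
rewrite addrCA lerDl subr_ge0; apply: avg_tail_anti; lia.
Qed.

End KeepProbability.

(** * Countable sums and independent coordinates *)

Lemma ge0_esumZl (R : realType) (T : choiceType) (D : set T) (a : T -> \bar R) (r : R) :
  0 <= r -> (forall x, (0 <= a x)%E) ->
  \esum_(x in D) (r%:E * a x)%E = (r%:E * \esum_(x in D) a x)%E.
Proof.
move=> r0 a0; rewrite /esum -ereal_supZl//; last first.
  by apply/set0P; exists 0%E; exists set0; [exact: fsets_set0|rewrite fsbig_set0].
congr ereal_sup; apply/seteqP; split => y /=.
- move=> [X [fX XD] <-]; exists (\sum_(x \in X) a x)%E; first by exists X.
  by rewrite ge0_mule_fsumr.
- by move=> [x [X [fX XD] <-] <-]; exists X => //; rewrite ge0_mule_fsumr.
Qed.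

Lemma esum_pair (R : realType) (A B : choiceType) (f : A -> B -> \bar R) :
  (forall x y, (0 <= f x y)%E) ->
  \esum_(w in [set: A * B]) f w.1 w.2 = \esum_(x in [set: A]) \esum_(y in [set: B]) f x y.
Proof.
move=> f0; rewrite esum_esum//; congr (esum _ _).
by apply/seteqP; split.
Qed.

Lemma esum_finType (R : realType) (A : finType) (f : A -> \bar R) :
  (forall x, (0 <= f x)%E) -> \esum_(x in [set: A]) f x = (\sum_x f x)%E.
Proof.
move=> f0; have -> : [set: A] = [set` enum A].
  by apply/seteqP; split => x //= _; rewrite mem_enum.
rewrite esum_fset; [|exact: finite_seq|by move=> x _].
by rewrite -fsbig_seq ?enum_uniq// big_enum.
Qed.

Lemma reindex_esumT (R : realType) (A B : choiceType) (e : A -> B) (f : B -> \bar R) :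
  bijective e -> \esum_(y in [set: B]) f y = \esum_(x in [set: A]) f (e x).
Proof. by move=> be; apply: reindex_esum; rewrite setTT_bijective. Qed.

(** Fubini for independent coordinates, by induction on [n]: the bijection [e] glues coordinate 0 to
    the others. *)
Lemma esum_ffun_prod (R : realType) (T : choiceType) n (f : 'I_n -> T -> R) (s : 'I_n -> R) :
  (forall i x, 0 <= f i x) -> (forall i, \esum_(x in [set: T]) (f i x)%:E = (s i)%:E) ->
  \esum_(z in [set: {ffun 'I_n -> T}]) (\prod_i f i (z i))%:E = (\prod_i s i)%:E.
Proof.
elim: n f s => [|n IH] f s f0 fs.
  have -> : [set: {ffun 'I_0 -> T}] = [set (ffun0 (card_ord 0) : {ffun 'I_0 -> T})].
    by apply/seteqP; split => // z _ /=; apply/ffunP => -[].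
  by rewrite esum_set1 ?big_ord0 ?lee_fin.
pose e (w : T * {ffun 'I_n -> T}) : {ffun 'I_n.+1 -> T} :=
  [ffun i => oapp w.2 w.1 (unlift ord0 i)].
rewrite (@reindex_esumT _ _ _ e); last first.
  exists (fun z : {ffun 'I_n.+1 -> T} => (z ord0, [ffun i => z (lift ord0 i)])) => [[x z]|z].
    congr pair; rewrite /= ?ffunE ?unlift_none//.
    by apply/ffunP => i; rewrite !ffunE liftK.
  by apply/ffunP => i; rewrite ffunE /=; case: unliftP => [j ->|->] //=; rewrite ffunE.
pose g x (z : {ffun 'I_n -> T}) := ((f ord0 x)%:E * (\prod_i f (lift ord0 i) (z i))%:E)%E.
rewrite (eq_esum (b := fun w => g w.1 w.2)); last first.
  move=> [x z] _; rewrite big_ord_recl /g -EFinM ffunE unlift_none /=.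
  by congr (_ * _)%:E; apply: eq_bigr => i _; rewrite ffunE liftK.
have p0 (z : {ffun 'I_n -> T}) : (0 <= (\prod_i f (lift ord0 i) (z i))%:E)%E by rewrite lee_fin prodr_ge0.
have g0 x z : (0 <= g x z)%E by apply: mule_ge0; [rewrite lee_fin f0|exact: p0].
rewrite (esum_pair g0).
rewrite (eq_esum (b := fun x => ((\prod_i s (lift ord0 i))%:E * (f ord0 x)%:E)%E)); last first.
  move=> x _; rewrite (@ge0_esumZl _ _ _ _ _ (f0 ord0 x) p0) muleC.
  by rewrite (IH (fun i => f (lift ord0 i)) (fun i => s (lift ord0 i))).
rewrite ge0_esumZl// ?fs ?big_ord_recl ?EFinM 1?muleC//.
- by apply: prodr_ge0 => i _; rewrite -lee_fin -fs esum_ge0// => x _; rewrite lee_fin.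
- by move=> x; rewrite lee_fin.
Qed.

Lemma esum_geometric (R : realType) (a r : R) : 0 <= a -> 0 < r < 1 ->
  \esum_(i in [set: nat]) (a * r ^+ i)%:E = (a / (1 - r))%:E.
Proof.
move=> a0 /andP[r0 r1]; rewrite -nneseries_esumT; last first.
  by move=> i; rewrite lee_fin mulr_ge0// exprn_ge0// ltW.
apply: cvg_lim => //.
rewrite (_ : (fun n => _) = EFin \o series (geometric a r)); last first.
  by apply/funext => k /=; rewrite sumEFin.
apply: cvg_EFin; first by near=> k.
by apply: cvg_geometric_series; rewrite ger0_norm ?ltW.
Unshelve. all: by end_near.
Qed.

(** With [r = expR (- e0)] and [K] the normalising constant, the nonnegative and the negative
    integers give geometric series with first terms [K] and [K * r], and [K + K * r = 1 - r]. *)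
Lemma esum_dlap_pmf (R : realType) (e0 : R) : 0 < e0 ->
  \esum_(x in [set: int]) (dlap_pmf e0 x)%:E = 1%E.
Proof.
move=> e00; have p0 x : (0 <= (dlap_pmf e0 x)%:E)%E by rewrite lee_fin dlap_pmf_ge0.
set E := expR e0; have E0 : 0 < E by apply: expR_gt0.
have E1 : 1 < E by rewrite -expR0 ltr_expR.
have r01 : 0 < E^-1 < 1 by rewrite invr_gt0 E0 invf_lt1.
have K0 : 0 <= (E - 1) / (E + 1) by rewrite divr_ge0//; lra.
rewrite (esumID [set x | exists n, Posz n = x])// !setTI.
have -> : [set x | exists n, Posz n = x] = [set Posz n | n in [set: nat]].
  by apply/seteqP; split => x /= [n]; [exists n|move=> _ ?; exists n].
have -> : ~` [set Posz n | n in [set: nat]] = [set Negz n | n in [set: nat]].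
  apply/seteqP; split => x /=; last by move=> [n _ <-] [m].
  by case: x => n H; [exfalso; apply: H; exists n|exists n].
rewrite !esum_image; [|by move=> m n _ _ []..].
under eq_esum do rewrite dlap_pmf_nat.
under [X in (_ + X)%E]eq_esum => n _.
  rewrite NegzE dlap_pmfN dlap_pmf_nat exprS mulrA; over.
rewrite !esum_geometric//; last by rewrite mulr_ge0// invr_ge0 ltW.
have [_ KV] := dlap_norm e0; rewrite -EFinD -mulrDl KV; congr EFin.
by rewrite addrC subrK divff// subr_eq0 gt_eqF//; case/andP: r01.
Qed.

(** * Tails and joint events of the noise *)

(* The probability that a vertex with [ell - d / 2 = x] keeps [c1]. *)
Definition dlap_tail (R : realType) (e0 : R) (x : int) : R :=
  fine (\esum_(z in [set: int]) (dlap_pmf e0 z * (x + z <= 0)%R%:R)%:E).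

Section DiscreteLaplace.
Context (R : realType) (e0 : R).
Hypothesis e00 : 0 < e0.

Let event_ge0 (b : int -> bool) z : (0 <= (dlap_pmf e0 z * (b z)%:R)%:E)%E.
Proof. by rewrite lee_fin mulr_ge0// dlap_pmf_ge0. Qed.

(** This yields both the finiteness of the mass of an event and, by subtraction, the mass of its
    complement. *)
Lemma esum_dlap_compl (b : int -> bool) :
  (\esum_(z in [set: int]) (dlap_pmf e0 z * (b z)%:R)%:E
   + \esum_(z in [set: int]) (dlap_pmf e0 z * (~~ b z)%:R)%:E = 1)%E.
Proof.
rewrite -esumD; [|by move=> z _; exact: event_ge0|].
  rewrite -(esum_dlap_pmf e00); apply: eq_esum => z _; rewrite -EFinD.
  by case: (b z); rewrite ?mulr0 ?mulr1 ?addr0 ?add0r.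
by move=> z _; exact: (event_ge0 (fun z => ~~ b z)).
Qed.

Lemma esum_dlap_tail x :
  \esum_(z in [set: int]) (dlap_pmf e0 z * (x + z <= 0)%R%:R)%:E = (dlap_tail e0 x)%:E.
Proof.
rewrite fineK// ge0_fin_numE; last by apply: esum_ge0 => z _; exact: (event_ge0 (fun z => x + z <= 0)).
apply: le_lt_trans (ltry 1); rewrite -(esum_dlap_compl (fun z => x + z <= 0)).
by rewrite leeDl// esum_ge0// => z _; exact: (event_ge0 (fun z => ~~ (x + z <= 0))).
Qed.

Lemma esum_dlap_tailC x :
  \esum_(z in [set: int]) (dlap_pmf e0 z * (~~ (x + z <= 0)%R)%:R)%:E
  = (1 - dlap_tail e0 x)%:E.
Proof.
have := esum_dlap_compl (fun z => x + z <= 0); rewrite esum_dlap_tail.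
case: (\esum_(z in _) _) => [r| |] //=.
by rewrite -EFinD => -[<-]; rewrite addrAC subrr add0r.
Qed.

(** Raising [x] by 1 removes exactly the outcome [z = - x] from the event, and the law is even. *)
Lemma dlap_tailB x : dlap_tail e0 x - dlap_tail e0 (x + 1) = dlap_pmf e0 x.
Proof.
apply/eqP; rewrite subr_eq; apply/eqP.
suff : ((dlap_tail e0 x)%:E = (dlap_pmf e0 x + dlap_tail e0 (x + 1))%:E)%E by case.
rewrite EFinD -!esum_dlap_tail -(dlap_pmfN _ x).
rewrite -(@esum_set1 _ _ (- x) (fun z => (dlap_pmf e0 z)%:E)) ?lee_fin ?dlap_pmf_ge0//.
rewrite (esum_mkcond [set - x]) -esumD.
- apply: eq_esum => z _.
  have -> : (z \in [set - x]) = (z == - x) by apply/idP/eqP; rewrite inE.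
  have -> : (x + z <= 0) = (z == - x) || (x + 1 + z <= 0) by clear; lia.
  case: eqP => [->|_]; last by rewrite add0e.
  have -> : (x + 1 - x <= 0) = false by clear; lia.
  by rewrite mulr1 mulr0 adde0.
- by move=> z _; case: ifP => // _; rewrite lee_fin dlap_pmf_ge0.
- by move=> z _; exact: (event_ge0 (fun z => x + 1 + z <= 0)).
Qed.

(** Under [z -> - z], the event [1 - x + z <= 0] becomes the complement of [x + z <= 0]. *)
Lemma dlap_tailN x : dlap_tail e0 x + dlap_tail e0 (1 - x) = 1.
Proof.
suff : ((dlap_tail e0 (1 - x))%:E = (1 - dlap_tail e0 x)%:E)%E by case=> ->; lra.
rewrite -esum_dlap_tail -esum_dlap_tailC.
rewrite (@reindex_esumT _ _ _ (fun z : int => - z)); last first.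
  by exists (fun z : int => - z) => z; rewrite opprK.
apply: eq_esum => z _; rewrite dlap_pmfN; congr (_ * (nat_of_bool _)%:R)%:E.
clear; lia.
Qed.

(** Splitting by the outcomes of the two comparisons gives four terms, each a product over
    coordinates; the coordinates other than [u] and [v] contribute total mass 1. *)
Lemma esum_dlap_two n (u v : 'I_n) (x y : int) (H : bool -> bool -> R) :
  u != v -> (forall a b, 0 <= H a b) ->
  \esum_(z in [set: {ffun 'I_n -> int}])
     ((\prod_i dlap_pmf e0 (z i)) * H (x + z u <= 0) (y + z v <= 0))%:E =
  (H true true * (dlap_tail e0 x * dlap_tail e0 y)
   + H true false * (dlap_tail e0 x * (1 - dlap_tail e0 y))
   + H false true * ((1 - dlap_tail e0 x) * dlap_tail e0 y)
   + H false false * ((1 - dlap_tail e0 x) * (1 - dlap_tail e0 y)))%:E.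
Proof.
move=> uv H0.
pose ev (b : bool) (x z : int) : R := (if b then x + z <= 0 else ~~ (x + z <= 0))%R%:R.
pose pr (b : bool) x := if b then dlap_tail e0 x else 1 - dlap_tail e0 x.
have evE b t : \esum_(z in [set: int]) (dlap_pmf e0 z * ev b t z)%:E = (pr b t)%:E.
  by case: b; [exact: esum_dlap_tail|exact: esum_dlap_tailC].
pose F (a b : bool) i z : R :=
  dlap_pmf e0 z * (if i == u then ev a x z else if i == v then ev b y z else 1).
pose S (a b : bool) i : R := if i == u then pr a x else if i == v then pr b y else 1.
have ev0 b t z : 0 <= ev b t z by exact: ler0n.
have F0 a b i z : 0 <= F a b i z.
  by rewrite mulr_ge0 ?dlap_pmf_ge0//; case: ifP => // _; case: ifP.
have FS a b i : \esum_(z in [set: int]) (F a b i z)%:E = (S a b i)%:E.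
  rewrite /F /S; case: ifP => // _; case: ifP => // _.
  by under eq_esum do rewrite mulr1; exact: esum_dlap_pmf.
have prod2 (A B : R) :
    \prod_(i < n) (if i == u then A else if i == v then B else 1) = A * B.
  rewrite (bigD1 u)//= eqxx; congr (_ * _); rewrite (bigD1 v) /=; last by rewrite eq_sym.
  rewrite [v == u]eq_sym (negPf uv) eqxx big1 ?mulr1// => i /andP[/negPf -> /negPf ->] //.
have prodF a b z : \prod_i F a b i (z i) =
    (\prod_i dlap_pmf e0 (z i)) * (ev a x (z u) * ev b y (z v)).
  rewrite big_split /=; congr (_ * _); rewrite -prod2; apply: eq_bigr => i _.
  by case: eqP => [->//|_]; case: eqP => [->|].
pose T (a b : bool) (z : {ffun 'I_n -> int}) : \bar R :=
  ((H a b)%:E * (\prod_i F a b i (z i))%:E)%E.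
have T0 a b z : (0 <= T a b z)%E.
  by rewrite mule_ge0 ?lee_fin// prodr_ge0.
have TS a b : \esum_(z in [set: {ffun 'I_n -> int}]) T a b z =
    (H a b * (pr a x * pr b y))%:E.
  rewrite ge0_esumZl//; last by move=> z; rewrite lee_fin prodr_ge0.
  by rewrite (esum_ffun_prod (F0 a b) (FS a b)) prod2.
rewrite (eq_esum (b := fun z => T true true z + T true false z + T false true z + T false false z)%E).
  rewrite !esumD ?TS ?EFinD//; by move=> z _; rewrite ?adde_ge0.
move=> z _; rewrite /T !prodF -!EFinM -!EFinD; congr EFin; rewrite /ev.
by case: (x + z u <= 0); case: (y + z v <= 0) => /=; lra.
Qed.

End DiscreteLaplace.

Lemma ceil_half_pred (R : realType) (d : nat) :
  Num.ceil ((d%:R - 1) / 2 : R) = (d./2)%:Z.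
Proof.
apply: ceil_def; rewrite -{2 3}(odd_double_half d) -muln2 natrD natrM -pmulrn.
by case: (odd d); rewrite ?mulr1n ?mulr0n; apply/andP; split; lra.
Qed.

(** * Uniform random colourings *)

Definition flip n (x : 'I_n) (c : {ffun 'I_n -> bool}) : {ffun 'I_n -> bool} :=
  [ffun y => if y == x then ~~ c y else c y].

Lemma flipE n (x y : 'I_n) c : flip x c y = if y == x then ~~ c y else c y.
Proof. by rewrite ffunE. Qed.

Lemma flipK n (x : 'I_n) : involutive (flip x).
Proof. by move=> c; apply/ffunP => y; rewrite !flipE; case: eqP => //; rewrite negbK. Qed.

Lemma sum_flip (R : realFieldType) n (x : 'I_n) (f : {ffun 'I_n -> bool} -> R) :
  \sum_c f c = (\sum_c (f c + f (flip x c))) / 2.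
Proof.
have -> : \sum_c (f c + f (flip x c)) = \sum_c f c + \sum_c f c.
  by rewrite big_split; congr (_ + _); exact/esym/(reindex_inj (inv_inj (@flipK n x))).
by lra.
Qed.

Lemma card_coloring n : #|{ffun 'I_n -> bool}| = (2 ^ n)%N.
Proof. by rewrite card_ffun card_bool card_ord. Qed.

Lemma sum_flip_half (R : realFieldType) n (x : 'I_n) (f : {ffun 'I_n -> bool} -> R) :
  (forall c, f c + f (flip x c) = 1) -> \sum_c f c = 2 ^+ n / 2.
Proof.
move=> f1; rewrite (sum_flip x) (eq_bigr (fun=> 1)) => [|c _]; last exact: f1.
by rewrite sumr_const card_coloring natrX.
Qed.

(* Only the vertices of [A] are resampled, so the weight [W] may depend on all
   the other colours, in particular on that of [u]. *)
Lemma sum_coloring_avg (R : realFieldType) n (u : 'I_n) (A : {set 'I_n})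
    (W : {ffun 'I_n -> bool} -> R) (phi : int -> R) (x : int) :
  u \notin A -> (forall y c, y \in A -> W (flip y c) = W c) ->
  \sum_(c : {ffun 'I_n -> bool}) W c * phi (x + (\sum_(y in A) (c y == c u))%N%:Z) =
  avg #|A| phi x * \sum_c W c.
Proof.
move: {2}#|A| (erefl #|A|) => m; elim: m A x => [|m IH] A x cA uA WA.
  rewrite cA /= mulr_sumr; apply: eq_bigr => c _.
  by rewrite (cards0_eq cA) big_set0 addr0 mulrC.
have /card_gt0P[a aA] : (0 < #|A|)%N by rewrite cA.
have cA' : #|(A :\ a)%SET| = m by move: (cardsD1 a A); rewrite aA cA => -[].
have uA' : u \notin (A :\ a)%SET by rewrite !inE negb_and uA orbT.
have WA' y c : y \in (A :\ a)%SET -> W (flip y c) = W c by rewrite !inE => /andP[_ /WA].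
have au : u == a = false by apply: contraNF uA => /eqP ->.
pose N (c : {ffun 'I_n -> bool}) := (\sum_(y in (A :\ a)%SET) (c y == c u))%N.
have NA (c : {ffun 'I_n -> bool}) : (\sum_(y in A) (c y == c u))%N = ((c a == c u) + N c)%N by rewrite (big_setD1 a).
have Nf c : N (flip a c) = N c.
  by apply: eq_bigr => y; rewrite !inE !flipE au => /andP[/negPf ->].
(* Flipping [a] toggles its agreement with [u] and preserves [N] and [W], so each pair contributes
   the offsets 0 and 1 of the recursion of [avg]. *)
rewrite [LHS](sum_flip a).
rewrite (eq_bigr (fun c => W c * phi (x + (N c)%:Z) + W c * phi (x + 1 + (N c)%:Z))).
  by rewrite big_split /= cA /= (IH (A :\ a)%SET x)// (IH (A :\ a)%SET (x + 1))// cA'; lra.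
move=> c _; rewrite (WA _ _ aA) !NA Nf !flipE eqxx au.
have e : x + (1 + N c)%N%:Z = x + 1 + (N c)%:Z by rewrite PoszD addrA.
by case: (c a); case: (c u); rewrite /= add0n e // addrC.
Qed.

Lemma mem_mkset_bool (T : Type) (P : T -> bool) x : (x \in [set y | P y]) = P x.
Proof. by apply/idP/idP; rewrite inE. Qed.

(** * Cut probability of an edge in a triangle-free graph *)

Definition nbrs n (G : rel 'I_n) (v w : 'I_n) : {set 'I_n} :=
  [set y | G v y & y != w]%SET.

Lemma deg_nbrs n (G : rel 'I_n) v w : G v w -> deg G v = #|nbrs G v w|.+1.
Proof.
move=> Gvw; have -> : deg G v = #|[set y | G v y]%SET|.
  by apply: eq_card => y; rewrite mem_mkset_bool !inE.
rewrite (cardsD1 w) inE Gvw; congr (_.+1).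
by apply: eq_card => y; rewrite !inE andbC.
Qed.

Lemma ell_nbrs n (G : rel 'I_n) (c : {ffun 'I_n -> bool}) v w : simple_graph G -> G v w ->
  ell G c v = ((c w == c v) + \sum_(y in nbrs G v w) (c y == c v))%N.
Proof.
move=> [Gsym _] Gvw; have -> : ell G c v = (\sum_(y in [set y | G v y]%SET) (c y == c v))%N.
  rewrite /ell -sum1_card big_mkcond [RHS]big_mkcond; apply: eq_bigr => y _.
  by rewrite mem_mkset_bool !inE Gsym; case: (G v y); case: (c y == c v).
rewrite (big_setD1 w) ?inE//; congr (_ + _)%N; apply: eq_bigl => y.
by rewrite !inE andbC.
Qed.

Section Utility.
Context (R : realType) (n : nat) (G : rel 'I_n) (u v : 'I_n).
Hypotheses (Gs : simple_graph G) (Gt : triangle_free G) (Guv : G u v).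

Let uv : u != v.
Proof. by apply: contraL Guv => /eqP ->; case: Gs. Qed.

Let Gvu : G v u.
Proof. by case: Gs => <-. Qed.

(** Three rounds of resampling: the other neighbours of [u], those of [v], then [u] itself.
    Triangle-freeness makes the two neighbourhoods disjoint, so the factor in [psi] belongs to the
    invariant weight of the first round. *)
Lemma sum_coloring_edge (phi psi : int -> R) (x y : int) (e : bool) :
  \sum_(c : {ffun 'I_n -> bool}) ((c u == c v) == e)%:R
    * (phi (x + (\sum_(z in nbrs G u v) (c z == c u))%N%:Z)
       * psi (y + (\sum_(z in nbrs G v u) (c z == c v))%N%:Z)) =
  2 ^+ n / 2 * (avg (deg G u).-1 phi x * avg (deg G v).-1 psi y).
Proof.
have [Gsym Girr] := Gs.
have Nu z : z \in nbrs G u v -> [/\ z != u, z != v & z \notin nbrs G v u].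
  rewrite !inE => /andP[Guz zv]; split => //.
    by apply: contraL Guz => /eqP ->.
  by rewrite negb_and; apply/orP; left; apply: (Gt (b := u)).
have Nv z : z \in nbrs G v u -> z != u /\ z != v.
  rewrite !inE => /andP[Gvz zu]; split => //.
  by apply: contraL Gvz => /eqP ->.
pose W0 (c : {ffun 'I_n -> bool}) : R := ((c u == c v) == e)%:R.
pose W1 (c : {ffun 'I_n -> bool}) :=
  W0 c * psi (y + (\sum_(z in nbrs G v u) (c z == c v))%N%:Z).
have W0f z c : z != u -> z != v -> W0 (flip z c) = W0 c.
  by move=> zu zv; rewrite /W0 !flipE ![_ == z]eq_sym (negPf zu) (negPf zv).
have W1f z c : z \in nbrs G u v -> W1 (flip z c) = W1 c.
  move=> /Nu[zu zv zN]; rewrite /W1 W0f//; congr (_ * psi (_ + Posz _)).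
  apply: eq_bigr => t tN; rewrite !flipE [v == z]eq_sym (negPf zv).
  by case: (t =P z) => // tz; case/negP: zN; rewrite -tz.
rewrite (eq_bigr (fun c => W1 c * phi (x + (\sum_(z in nbrs G u v) (c z == c u))%N%:Z))); last first.
  by move=> c _; rewrite /W1 /W0; lra.
rewrite sum_coloring_avg//; last by rewrite !inE (negPf (Girr u)).
rewrite /W1 sum_coloring_avg; first last.
- by move=> z c /Nv[zu zv]; exact: W0f.
- by rewrite !inE (negPf (Girr v)).
rewrite (sum_flip_half (x := u)) => [|c].
  by rewrite (deg_nbrs Guv) (deg_nbrs Gvu) /=; lra.
rewrite /W0 !flipE eqxx [v == u]eq_sym (negPf uv).
by case: (c u) (c v) (e) => -[] []; rewrite /= ?addr0 ?add0r.
Qed.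

Lemma mem_mech_out c1 c2 (z : {ffun 'I_n -> int}) w :
  (w \in mech_out R G (c1, c2, z)) =
  if (ell G c1 w)%:Z - (deg G w)./2%:Z + z w <= 0 then c1 w else c2 w.
Proof. by rewrite inE /= ceil_half_pred. Qed.

(** The term [p x * q y] comes from an edge that [c1] cuts, where [ell] counts only the other
    neighbours. On an edge that [c1] does not cut, each endpoint also counts the other, hence the
    shift by 1 in both arguments. *)
Lemma mech_prob_cut (eps : R) : 0 < eps ->
  let p := avg (deg G u).-1 (dlap_tail (eps / 2)) in
  let q := avg (deg G v).-1 (dlap_tail (eps / 2)) in
  let x := - ((deg G u)./2)%:Z in let y := - ((deg G v)./2)%:Z in
  mech_prob eps G [set S : {set 'I_n} | (u \in S) != (v \in S)] =
  (1 / 2 + 1 / 4 * (p x * q y - p (x + 1) * q (y + 1)))%:E.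
Proof.
move=> eps0 p q x y; have e00 : 0 < eps / 2 by rewrite divr_gt0.
set e0 := eps / 2 in e00 p q *.
pose H (c1 c2 : {ffun 'I_n -> bool}) (a b : bool) : R :=
  ((if a then c1 u else c2 u) != (if b then c1 v else c2 v))%:R.
pose X (c1 : {ffun 'I_n -> bool}) := dlap_tail e0 ((ell G c1 u)%:Z + x).
pose Y (c1 : {ffun 'I_n -> bool}) := dlap_tail e0 ((ell G c1 v)%:Z + y).
(* Conditional probability of a cut given both colourings, the noise being summed out. *)
pose K c1 c2 := H c1 c2 true true * (X c1 * Y c1) + H c1 c2 true false * (X c1 * (1 - Y c1))
  + H c1 c2 false true * ((1 - X c1) * Y c1)
  + H c1 c2 false false * ((1 - X c1) * (1 - Y c1)).
have r4 : 0 <= (4 ^- n : R) by rewrite invr_ge0 exprn_ge0.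
pose f (c : {ffun 'I_n -> bool} * {ffun 'I_n -> bool}) (z : {ffun 'I_n -> int}) : R :=
  (\prod_i dlap_pmf e0 (z i)) *
  H c.1 c.2 ((ell G c.1 u)%:Z + x + z u <= 0)%R ((ell G c.1 v)%:Z + y + z v <= 0)%R.
have f0 c z : (0 <= (f c z)%:E)%E.
  rewrite lee_fin mulr_ge0// ?ler0n// prodr_ge0// => i _; exact: dlap_pmf_ge0.
have fK c : \esum_(z in [set: {ffun 'I_n -> int}]) (f c z)%:E = (K c.1 c.2)%:E.
  by rewrite esum_dlap_two// => a b; rewrite ler0n.
have -> : mech_prob eps G [set S : {set 'I_n} | (u \in S) != (v \in S)] =
    (4 ^- n * \sum_c1 \sum_c2 K c1 c2)%:E.
  pose g c z := ((4 ^- n)%:E * (f c z)%:E)%E.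
  have g0 c z : (0 <= g c z)%E by rewrite mule_ge0// lee_fin.
  transitivity (\esum_(w in [set: rand_space n]) g w.1 w.2).
    apply: eq_esum => -[[c1 c2] z] _.
    rewrite [X in (_ * (if X then _ else _))%E](_ : _ =
      ((if (ell G c1 u)%:Z + x + z u <= 0 then c1 u else c2 u)
       != (if (ell G c1 v)%:Z + y + z v <= 0 then c1 v else c2 v))); last first.
      by rewrite asboolb !mem_mech_out.
    rewrite /g /f /H /rand_mass /= -/e0 -EFinM mulrA.
    by case: (_ != _); rewrite ?mulr1 ?mule1 ?mulr0 ?mule0.
  rewrite (esum_pair g0).
  rewrite (eq_esum (b := fun c => (4 ^- n * K c.1 c.2)%:E)) => [|c _]; last first.
    by rewrite ge0_esumZl// fK.
  have K0 c : 0 <= K c.1 c.2 by rewrite -lee_fin -fK esum_ge0.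
  rewrite esum_finType; last by move=> c; rewrite lee_fin mulr_ge0.
  by rewrite sumEFin -mulr_sumr pair_bigA.
congr EFin.
(* Whenever an endpoint falls back on [c2], flipping that colour alone shows a cut probability of
   one half; only the term where both keep [c1] deviates. *)
have Ksum c1 : \sum_c2 K c1 c2 = 2 ^+ n / 2 * (1 +
    ((c1 u == c1 v) == false)%:R * (X c1 * Y c1) - ((c1 u == c1 v) == true)%:R * (X c1 * Y c1)).
  have Htt : \sum_c2 H c1 c2 true true = 2 ^+ n * (c1 u != c1 v)%:R.
    by rewrite /H sumr_const card_coloring -natrX mulrC mulr_natr.
  have Htf : \sum_c2 H c1 c2 true false = 2 ^+ n / 2.
    rewrite (sum_flip_half (x := v)) => // c; rewrite /H flipE eqxx.
    by case: (c v) (c1 u) => -[]; rewrite /= ?addr0 ?add0r.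
  have Hft : \sum_c2 H c1 c2 false true = 2 ^+ n / 2.
    rewrite (sum_flip_half (x := u)) => // c; rewrite /H flipE eqxx.
    by case: (c u) (c1 v) => -[]; rewrite /= ?addr0 ?add0r.
  have Hff : \sum_c2 H c1 c2 false false = 2 ^+ n / 2.
    rewrite (sum_flip_half (x := u)) => // c; rewrite /H !flipE eqxx [v == u]eq_sym (negPf uv).
    by case: (c u) (c v) => -[]; rewrite /= ?addr0 ?add0r.
  rewrite /K !big_split /= -!mulr_suml Htt Htf Hft Hff.
  by case: (c1 u == c1 v) => /=; lra.
under eq_bigr do rewrite Ksum.
rewrite -mulr_sumr sumrB big_split /= sumr_const card_coloring.
rewrite (eq_bigr (fun c : {ffun 'I_n -> bool} => ((c u == c v) == false)%:R
    * (dlap_tail e0 (x + (\sum_(z in nbrs G u v) (c z == c u))%N%:Z)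
       * dlap_tail e0 (y + (\sum_(z in nbrs G v u) (c z == c v))%N%:Z)))); last first.
  move=> c _; rewrite /X /Y (ell_nbrs c Gs Guv) (ell_nbrs c Gs Gvu) [c v == c u]eq_sym [c u == c v]eq_sym.
  case: (c v == c u) => /=; first by rewrite !mul0r.
  by rewrite !add0n ![_%:Z + _]addrC.
rewrite sum_coloring_edge.
rewrite [X in _ - X](eq_bigr (fun c : {ffun 'I_n -> bool} => ((c u == c v) == true)%:R
    * (dlap_tail e0 (x + 1 + (\sum_(z in nbrs G u v) (c z == c u))%N%:Z)
       * dlap_tail e0 (y + 1 + (\sum_(z in nbrs G v u) (c z == c v))%N%:Z)))); last first.
  move=> c _; rewrite /X /Y (ell_nbrs c Gs Guv) (ell_nbrs c Gs Gvu) [c v == c u]eq_sym.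
  case: (c u == c v) => /=; last by rewrite !mul0r.
  have e (N : nat) (t : int) : (1 + N)%N%:Z + t = t + 1 + N%:Z by rewrite PoszD addrC addrA.
  by rewrite !e.
rewrite sum_coloring_edge -/p -/q.
rewrite (_ : 4 = 2 * 2) ?exprMn; last by lra.
rewrite natrX; set t := 2 ^+ n; set P := p x * q y; set Q := _ * q (y + 1).
have -> : t / 2 * (t + t / 2 * P - t / 2 * Q) = t * t * (1 / 2 + 1 / 4 * (P - Q)) by lra.
rewrite mulKf; [lra|by rewrite mulf_neq0 ?expf_neq0].
Qed.

(** The gain is split by [p q - p' q' = ((p - p')(q + q') + (q - q')(p + p')) / 2], where each sum
    is at least 1 and each difference is at least [1 / 16] of an inverse root. The constant is
    [(1 / 4) * (1 / 2) * (1 / 16)]. *)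
Lemma mech_prob_cut_ge (eps : R) : 0 < eps ->
  ((1 / 2 + 1 / 128 * (1 / Num.sqrt ((deg G u)%:R + 1 / eps ^+ 2)
                     + 1 / Num.sqrt ((deg G v)%:R + 1 / eps ^+ 2)))%:E
   <= mech_prob eps G [set S : {set 'I_n} | (u \in S) != (v \in S)])%E.
Proof.
move=> eps0; rewrite mech_prob_cut// lee_fin lerD2l.
have e00 : 0 < eps / 2 by rewrite divr_gt0.
have du : (0 < deg G u)%N by rewrite (deg_nbrs Guv).
have dv : (0 < deg G v)%N by rewrite (deg_nbrs Gvu).
have := avg_dlap_ge eps0 du; have := avg_dlap_ge eps0 dv.
rewrite -!(avg_tailB (dlap_tailB e00)).
have := avg_tailD_ge1 e00 (dlap_tailB e00) (dlap_tailN e00) du.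
have := avg_tailD_ge1 e00 (dlap_tailB e00) (dlap_tailN e00) dv.
set p := avg (deg G u).-1 _ _; set p' := avg (deg G u).-1 _ _.
set q := avg (deg G v).-1 _ _; set q' := avg (deg G v).-1 _ _.
set b := 1 / Num.sqrt ((deg G v)%:R + _); set a := 1 / Num.sqrt _.
have a0 : 0 <= a by rewrite divr_ge0 ?sqrtr_ge0.
have b0 : 0 <= b by rewrite divr_ge0 ?sqrtr_ge0.
move=> hq hp hb ha.
have prod_ge (t s1 s2 : R) : 0 <= t -> 1 / 16 * t <= s1 -> 1 <= s2 -> t / 16 <= s1 * s2.
  move=> t0 h1 h2; have -> : t / 16 = 1 / 16 * t * 1 by lra.
  by apply: ler_pM; rewrite ?mulr_ge0.
have h1 := prod_ge _ _ _ a0 ha hq; have h2 := prod_ge _ _ _ b0 hb hp.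
have -> : p * q - p' * q' = ((p - p') * (q + q') + (q - q') * (p + p')) / 2 by lra.
lra.
Qed.

End Utility.

(** * Privacy under the change of one edge *)

Definition keep_offset n (G : rel 'I_n) (c : {ffun 'I_n -> bool}) (v : 'I_n) : int :=
  (ell G c v)%:Z - ((deg G v)./2)%:Z.

Lemma dlap_pmf_shift (R : realType) (e0 : R) (z s : int) : 0 < e0 ->
  dlap_pmf e0 z <= expR (e0 * `|s|%:~R) * dlap_pmf e0 (z + s).
Proof.
move=> e00; rewrite /dlap_pmf mulrCA ler_wpM2l ?divr_ge0//.
  by rewrite subr_ge0 -expR0 ler_expR ltW.
rewrite -expRD ler_expR -mulrBr -mulrN ler_pM2l// -intrB -intrN ler_int.
have := ler_normB (z + s) s; rewrite addrK; clear; lia.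
Qed.

Section Privacy.
Context (R : realType) (n : nat) (G G' : rel 'I_n).
Hypotheses (Gs : simple_graph G) (Gs' : simple_graph G').

Lemma keep_offset_eq c v : (forall y, G v y = G' v y) ->
  keep_offset G c v = keep_offset G' c v.
Proof.
move=> e; rewrite /keep_offset; congr (Posz _ - Posz (_./2)).
  by apply: eq_card => y; rewrite !mem_mkset_bool Gs.1 e -Gs'.1.
by apply: eq_card => y; rewrite !mem_mkset_bool e.
Qed.

(* Adding one neighbour [w] of [v] raises [ell v] by [c w == c v] and the
   threshold by 0 or 1, so that the two changes never add up. *)
Lemma keep_offset_add c v w : G v w -> ~~ G' v w ->
  (forall y, y != w -> G v y = G' v y) ->
  `|keep_offset G c v - keep_offset G' c v| <= 1.
Proof.
move=> Gvw Gvw' e; rewrite /keep_offset (deg_nbrs Gvw) (ell_nbrs c Gs Gvw).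
have -> : deg G' v = #|nbrs G v w|.
  apply: eq_card => y; rewrite mem_mkset_bool !inE; have [->|/e ->] := eqVneq y w.
    by rewrite (negPf Gvw') andbF.
  by rewrite andbT.
have -> : ell G' c v = (\sum_(y in nbrs G v w) (c y == c v))%N.
  rewrite /ell -sum1_card big_mkcond [RHS]big_mkcond; apply: eq_bigr => y _.
  rewrite mem_mkset_bool !inE Gs'.1; have [->|/e ->] := eqVneq y w.
    by rewrite (negPf Gvw') andbF.
  by rewrite andbT; case: (G' v y); case: (c y == c v).
move: #|_| (\sum_(y in _) _)%N (c w == c v) => d l b; clear.
case: b; lia.
Qed.

End Privacy.

Lemma keep_offset_edge n (G G' : rel 'I_n) (c : {ffun 'I_n -> bool}) v w :
  simple_graph G -> simple_graph G' -> G v w != G' v w ->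
  (forall y, y != w -> G v y = G' v y) ->
  `|keep_offset G c v - keep_offset G' c v| <= 1.
Proof.
move=> Gs Gs' ne e; case Gvw : (G v w) ne; case Gvw' : (G' v w) => // _.
- by apply: (keep_offset_add _ _ _ Gvw); rewrite ?Gvw'.
- rewrite distrC; apply: (keep_offset_add _ _ _ Gvw'); rewrite ?Gvw//.
  by move=> y /e.
Qed.

Lemma mech_prob_neighbors (R : realType) (eps : R) n (G G' : rel 'I_n) (T : set {set 'I_n}) :
  0 < eps -> simple_graph G -> simple_graph G' -> edge_neighbors G G' ->
  (mech_prob eps G T <= (expR eps)%:E * mech_prob eps G' T)%E.
Proof.
move=> eps0 Gs Gs' [a [b [ab [Gab GE]]]]; have e00 : 0 < eps / 2 by rewrite divr_gt0.
pose s (c : {ffun 'I_n -> bool}) v := keep_offset G c v - keep_offset G' c v.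
have sa c : `|s c a| <= 1.
  apply: (@keep_offset_edge _ _ _ c a b) => // y yb; apply: GE.
  by rewrite (negPf yb) (negPf ab) !andbF.
have sb c : `|s c b| <= 1.
  apply: (@keep_offset_edge _ _ _ c b a) => [//|//||y ya].
    by rewrite Gs.1 Gs'.1.
  by apply: GE; rewrite (negPf ya) [b == a]eq_sym (negPf ab) andbF.
have s0 c v : v != a -> v != b -> s c v = 0.
  move=> va vb; apply/eqP; rewrite subr_eq0; apply/eqP/keep_offset_eq => // y.
  by apply: GE; rewrite (negPf va) (negPf vb).
(* The translation depends only on [c1], which it fixes, so subtracting the same amounts inverts
   it. *)
pose shift (w : rand_space n) : rand_space n := (w.1, [ffun v => w.2 v + s w.1.1 v]).
have shift_bij : bijective shift.
  exists (fun w : rand_space n => (w.1, [ffun v => w.2 v - s w.1.1 v])) => -[c z];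
    by congr pair; apply/ffunP => v; rewrite !ffunE /= ?addrK ?subrK.
have out w : mech_out R G w = mech_out R G' (shift w).
  case: w => [[c1 c2] z]; apply/setP => v; rewrite !mem_mech_out ffunE /=.
  have -> // : (ell G c1 v)%:Z - (deg G v)./2%:Z + z v =
    (ell G' c1 v)%:Z - (deg G' v)./2%:Z + (z v + s c1 v).
  by rewrite /s /keep_offset; lia.
have mass0 w : 0 <= rand_mass eps w :> R.
  by rewrite mulr_ge0 ?invr_ge0 ?exprn_ge0// prodr_ge0// => i _; exact: dlap_pmf_ge0.
have mass w : rand_mass eps w <= expR eps * rand_mass eps (shift w).
  rewrite /rand_mass mulrCA ler_wpM2l ?invr_ge0 ?exprn_ge0//.
  apply: (@le_trans _ _ (\prod_v (expR (eps / 2 * `|s w.1.1 v|%:~R)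
      * dlap_pmf (eps / 2) ((shift w).2 v)))).
    apply: ler_prod => v _; rewrite dlap_pmf_ge0//= ffunE.
    exact: dlap_pmf_shift.
  rewrite big_split /= ler_wpM2r//.
    by apply: prodr_ge0 => i _; exact: dlap_pmf_ge0.
  rewrite (bigD1 a)//= (bigD1 b) 1?eq_sym//= big1 ?mulr1; last first.
    by move=> v /andP[va vb]; rewrite s0// normr0 mulr0 expR0.
  rewrite -expRD ler_expR -mulrDr.
  have := sa w.1.1; have := sb w.1.1.
  rewrite -2!(ler_int R) => hb ha.
  have : eps / 2 * (`|s w.1.1 a|%:~R + `|s w.1.1 b|%:~R) <= eps / 2 * (1 + 1).
    by rewrite ler_pM2l// lerD.
  by lra.
(* Reindexing the right-hand sum by [shift] aligns the outputs and leaves a pointwise comparison of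
   masses. *)
rewrite /mech_prob [X in (_ <= _ * X)%E](@reindex_esumT _ _ _ shift)//.
rewrite -ge0_esumZl ?expR_ge0//; last first.
  by move=> w; rewrite mule_ge0 ?lee_fin//; case: ifP.
apply: le_esum => w _; rewrite out; case: ifP => _; last by rewrite !mule0.
by rewrite !mule1 -EFinM lee_fin.
Qed.

Theorem theorem5p5 (R : realType) :
  (forall (eps : R) (n : nat), 0 < eps -> (0 < n)%N ->
     forall G G' : rel 'I_n, simple_graph G -> simple_graph G' ->
     edge_neighbors G G' ->
     forall T : set {set 'I_n},
       (mech_prob eps G T <= (expR eps)%:E * mech_prob eps G' T)%E)
  /\
  (exists C : R, 0 < C /\
     forall (eps : R) (n : nat), 0 < eps -> (0 < n)%N ->
     forall G : rel 'I_n, simple_graph G -> triangle_free G ->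
     forall u v : 'I_n, G u v ->
       ((1 / 2 + C * (1 / Num.sqrt ((deg G u)%:R + 1 / eps ^+ 2)
                    + 1 / Num.sqrt ((deg G v)%:R + 1 / eps ^+ 2)))%:E
        <= mech_prob eps G [set S | (u \in S) != (v \in S)])%E).
Proof.
split=> [eps n eps0 _ G G' Gs Gs' GG' T|]; first exact: mech_prob_neighbors.
exists (1 / 128); split=> [|eps n eps0 _ G Gs Gt u v Guv]; first by rewrite divr_gt0.
exact: mech_prob_cut_ge.
Qed.
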